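(* Let $K$ be a field with $|K|=\aleph_0$ and $\operatorname{char}K\neq 2$, and let $F_2$ be the free group with $2$ generators. Then there exists a continuum of pairwise non-isomorphic simple (right) modules over the group ring $KF_2$; that is, there is a family of cardinality $2^{\aleph_0}$ of simple right $KF_2$-modules no two distinct members of which are isomorphic as $KF_2$-modules.
   Context: All modules are right modules. $KF_2$ denotes the group algebra of $F_2$ over $K$. *)

(* Defs.v *)
From HB Require Import structures.
From mathcomp Require Import all_boot all_algebra.
From mathcomp Require Import finmap monalg.

Set Implicit Arguments.
Unset Strict Implicit.
Unset Printing Implicit Defensive.

Import GRing.Theory.

Local Open Scope ring_scope.
Local Open Scope group_scope.

(* The free group on X is the set of reduced words in the letters             *)
(* (x, true) = x and (x, false) = x^-1, with concatenation followed by free   *)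
(* reduction as product.                                                      *)
Section ReducedWords.
Variable X : choiceType.
Implicit Types (a b : X * bool) (u v w : seq (X * bool)).

Definition letter_inv a : X * bool := (a.1, ~~ a.2).

Definition reduced : pred (seq (X * bool)) :=
  sorted (fun a b => b != letter_inv a).

Definition word_cons a w : seq (X * bool) :=
  if w is b :: w' then if b == letter_inv a then w' else a :: w else [:: a].

Definition word_mul u v : seq (X * bool) := foldr word_cons v u.

Definition word_inv w : seq (X * bool) := rev (map letter_inv w).

Lemma letter_invK : involutive letter_inv.
Proof. by case=> x b; rewrite /letter_inv /= negbK. Qed.

Lemma reduced_behead a w : reduced (a :: w) -> reduced w.
Proof. exact: path_sorted. Qed.

Lemma word_cons_reduced a w : reduced w -> reduced (word_cons a w).
Proof.
case: w => [|b w] //= rw; case: ifP => [_|/negbT nba]; first exact: path_sorted rw.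
by rewrite /= nba.
Qed.

Lemma word_mul_reduced u v : reduced v -> reduced (word_mul u v).
Proof. by move=> rv; elim: u => //= a u; apply: word_cons_reduced. Qed.

Lemma word_consK a w :
  reduced w -> word_cons (letter_inv a) (word_cons a w) = w.
Proof.
case: w => [|b w] /=; first by rewrite letter_invK eqxx.
case: eqP => [->|_] /=; last by rewrite letter_invK eqxx.
by case: w => [|c w] //= /andP[/negPf ->].
Qed.

Lemma word_consVK a w :
  reduced w -> word_cons a (word_cons (letter_inv a) w) = w.
Proof. by move/(word_consK (letter_inv a)); rewrite letter_invK. Qed.

Lemma word_consE a w : reduced (a :: w) -> word_cons a w = a :: w.
Proof. by case: w => [|b w] //= /andP[/negPf->]. Qed.

Lemma word_mul_cons a u w :
  reduced w -> word_mul (word_cons a u) w = word_cons a (word_mul u w).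
Proof.
case: u => [|b u] //= rw; case: eqP => // ->.
by rewrite word_consVK // word_mul_reduced.
Qed.

Lemma word_mulA u v w :
  reduced w -> word_mul u (word_mul v w) = word_mul (word_mul u v) w.
Proof.
by move=> rw; elim: u => //= a u ->; rewrite word_mul_cons.
Qed.

Lemma word_mulw1 u : reduced u -> word_mul u [::] = u.
Proof.
by elim: u => //= a u IH ru; rewrite IH ?word_consE //; apply: path_sorted ru.
Qed.

Lemma word_inv_reduced u : reduced u -> reduced (word_inv u).
Proof.
rewrite /reduced /word_inv rev_sorted sorted_map.
apply: sub_sorted => a b /=; rewrite letter_invK.
by apply: contraNN => /eqP ->.
Qed.

Lemma word_invK : involutive word_inv.
Proof.
move=> u; rewrite /word_inv map_rev revK -map_comp map_id_in // => a _ /=.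
exact: letter_invK.
Qed.

Lemma word_mulVw u w : reduced w -> word_mul (word_inv u) (word_mul u w) = w.
Proof.
elim: u w => // a u IH w rw; rewrite /word_inv /= rev_cons -cats1.
rewrite {1}/word_mul foldr_cat /= word_consK ?word_mul_reduced //.
exact: IH.
Qed.

End ReducedWords.

Record free_group (X : choiceType) := FreeGroup {
  word : seq (X * bool);
  word_reduced : reduced word
}.

HB.instance Definition _ (X : choiceType) := [isSub for @word X].
HB.instance Definition _ (X : choiceType) := [Choice of free_group X by <:].

Section FreeGroup.
Variable X : choiceType.
Implicit Types u v w : free_group X.

Definition fgroup_one : free_group X := @FreeGroup X [::] isT.
Definition fgroup_mul u v : free_group X :=
  FreeGroup (word_mul_reduced (word u) (word_reduced v)).
Definition fgroup_inv u : free_group X :=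
  FreeGroup (word_inv_reduced (word_reduced u)).

Fact fgroup_mulA : associative fgroup_mul.
Proof. by move=> u v w; apply/val_inj/word_mulA/word_reduced. Qed.

Fact fgroup_mul1 : left_id fgroup_one fgroup_mul.
Proof. by move=> u; apply/val_inj. Qed.

Fact fgroup_mulr1 : right_id fgroup_one fgroup_mul.
Proof. by move=> u; apply/val_inj/word_mulw1/word_reduced. Qed.

Fact fgroup_mulV : left_inverse fgroup_one fgroup_inv fgroup_mul.
Proof.
move=> u; apply/val_inj => /=.
by rewrite -[X in word_mul _ X](word_mulw1 (word_reduced u)) word_mulVw.
Qed.

Fact fgroup_mulrV : right_inverse fgroup_one fgroup_inv fgroup_mul.
Proof.
move=> u; have {1}-> : u = fgroup_inv (fgroup_inv u).
  by apply/val_inj; rewrite /= word_invK.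
exact: fgroup_mulV.
Qed.

HB.instance Definition _ := isGroup.Build (free_group X)
  fgroup_mulA fgroup_mul1 fgroup_mulr1 fgroup_mulV fgroup_mulrV.

Definition fgroup_gen (x : X) : free_group X := @FreeGroup X [:: (x, true)] isT.

End FreeGroup.

Section FreeGroupUniversal.
Variables (X : choiceType) (H : groupType) (f : X -> H).

Definition letter_eval (a : X * bool) : H := if a.2 then f a.1 else (f a.1)^-1.

Definition fgroup_lift (u : free_group X) : H :=
  foldr (fun a h => letter_eval a * h) 1 (word u).

Lemma fgroup_liftM : {morph fgroup_lift : u v / u * v}.
Proof.
move=> u v; rewrite /fgroup_lift /= /word_mul.
elim: (word u) => [|a s IH] /=; first by rewrite mul1g.
rewrite -mulgA -IH; case: (foldr _ _ s) => [|b t] //=; case: eqP => //= ->.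
rewrite mulgA; suff -> : letter_eval a * letter_eval (letter_inv a) = 1.
  by rewrite mul1g.
by case: a => x [] /=; rewrite /letter_eval /= (mulgV, mulVg).
Qed.

Lemma fgroup_lift_gen x : fgroup_lift (fgroup_gen x) = f x.
Proof. by rewrite /fgroup_lift /= mulg1. Qed.

Lemma fgroup_lift_uniq (g : free_group X -> H) :
  {morph g : u v / u * v} -> (forall x, g (fgroup_gen x) = f x) -> g =1 fgroup_lift.
Proof.
move=> gM gX; have g1 : g 1 = 1 by apply: (mulgI (g 1)); rewrite -gM !mulg1.
have gV x : g (fgroup_gen x)^-1 = (f x)^-1.
  by apply: (mulgI (f x)); rewrite -{1}gX -gM !mulgV.
case; elim=> [|a s IH] rs; first by rewrite -[RHS]g1; congr g; apply/val_inj.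
have rs' := reduced_behead rs.
have gL : g (FreeGroup (isT : reduced [:: a])) = letter_eval a.
  case: a {rs} => x [].
    by rewrite /letter_eval -gX; congr g; apply/val_inj.
  by rewrite /letter_eval -gV; congr g; apply/val_inj.
rewrite /fgroup_lift /= -[foldr _ _ s]/(fgroup_lift (FreeGroup rs')) -IH -gL -gM.
by congr g; apply/val_inj; rewrite /= word_consE.
Qed.

End FreeGroupUniversal.

Close Scope group_scope.

(* monalg puts a ring structure on {malg R[M]} only for a monomType M, in     *)
(* which 1 is the only invertible element; this excludes groups, hence the    *)
(* ring structure below on an alias of the free module {malg R[G]}.           *)
Definition group_algebra (R : nzRingType) (G : groupType) : Type := {malg R[G]}.

Section GroupAlgebra.
Variables (R : nzRingType) (G : groupType).

Local Notation RG := (group_algebra R G).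
Implicit Types (g : RG) (c : R) (k : G).

HB.instance Definition _ := GRing.Lmodule.copy RG {malg R[G]}.

Definition galg_one : RG := << 1%g >>.

Definition galg_mul g1 g2 : RG :=
  \sum_(k1 <- msupp g1) \sum_(k2 <- msupp g2)
    << g1@_k1 * g2@_k2 *g (k1 * k2)%g >>.

Lemma galg_mulw (d1 d2 : {fset G}) g1 g2 :
  (msupp g1 `<=` d1)%fset -> (msupp g2 `<=` d2)%fset ->
  galg_mul g1 g2 =
    \sum_(k1 <- d1) \sum_(k2 <- d2) << g1@_k1 * g2@_k2 *g (k1 * k2)%g >>.
Proof.
move=> le1 le2; rewrite /galg_mul (big_fset_incl _ le1) /=.
  apply/eq_bigr=> k1 _; apply/big_fset_incl => // k _ /mcoeff_outdom ->.
  by rewrite mulr0 monalgU0.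
move=> k _ /mcoeff_outdom g1k.
by rewrite big1 => // k' _; rewrite g1k mul0r monalgU0.
Qed.

Lemma galg_mulDl : left_distributive galg_mul +%R.
Proof.
move=> g1 g2 g; pose d := (msupp g1 `|` msupp g2)%fset.
have [le1 le2] : (msupp g1 `<=` d)%fset /\ (msupp g2 `<=` d)%fset.
  by rewrite fsubsetUl fsubsetUr.
have leD : (msupp (g1 + g2 : {malg R[G]}) `<=` d)%fset by apply: msuppD_le.
rewrite (galg_mulw leD (fsubset_refl _)) (galg_mulw le1 (fsubset_refl _)).
rewrite (galg_mulw le2 (fsubset_refl _)) -big_split /=; apply/eq_bigr=> k1 _.
rewrite -big_split /=; apply/eq_bigr=> k2 _.
by rewrite mcoeffD mulrDl monalgUD.
Qed.

Lemma galg_mulDr : right_distributive galg_mul +%R.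
Proof.
move=> g g1 g2; pose d := (msupp g1 `|` msupp g2)%fset.
have [le1 le2] : (msupp g1 `<=` d)%fset /\ (msupp g2 `<=` d)%fset.
  by rewrite fsubsetUl fsubsetUr.
have leD : (msupp (g1 + g2 : {malg R[G]}) `<=` d)%fset by apply: msuppD_le.
rewrite (galg_mulw (fsubset_refl _) leD) (galg_mulw (fsubset_refl _) le1).
rewrite (galg_mulw (fsubset_refl _) le2) -big_split /=; apply/eq_bigr=> k1 _.
rewrite -big_split /=; apply/eq_bigr=> k2 _.
by rewrite mcoeffD mulrDr monalgUD.
Qed.

Lemma galg_mul0 : left_zero 0 galg_mul.
Proof. by move=> g; rewrite /galg_mul msupp0 big_seq_fset0. Qed.

Lemma galg_mulr0 : right_zero 0 galg_mul.
Proof.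
by move=> g; rewrite /galg_mul big1 // => k _; rewrite msupp0 big_seq_fset0.
Qed.

Lemma galg_mulUU c1 c2 k1 k2 :
  galg_mul << c1 *g k1 >> << c2 *g k2 >> = << c1 * c2 *g (k1 * k2)%g >>.
Proof. by rewrite (galg_mulw msuppU_le msuppU_le) !big_seq_fset1 !mcoeffUU. Qed.

Lemma galg_mulEl g1 g2 :
  galg_mul g1 g2 = \sum_(k <- msupp g1) galg_mul << g1@_k *g k >> g2.
Proof.
apply/eq_bigr=> k _; rewrite (galg_mulw msuppU_le (fsubset_refl _)).
by rewrite big_seq_fset1; apply/eq_bigr=> k' _; rewrite mcoeffUU.
Qed.

Lemma galg_mulEr g1 g2 :
  galg_mul g1 g2 = \sum_(k <- msupp g2) galg_mul g1 << g2@_k *g k >>.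
Proof.
rewrite {1}/galg_mul exchange_big; apply/eq_bigr=> k _.
rewrite (galg_mulw (fsubset_refl _) msuppU_le).
by apply/eq_bigr=> k' _; rewrite big_seq_fset1 mcoeffUU.
Qed.

Fact galg_mulA : associative galg_mul.
Proof.
move=> g1 g2 g3.
have suml I (r : seq I) (F : I -> RG) g :
    galg_mul (\sum_(i <- r) F i) g = \sum_(i <- r) galg_mul (F i) g.
  exact: (big_morph (galg_mul^~ g) (fun _ _ => galg_mulDl _ _ _) (galg_mul0 _)).
have sumr I (r : seq I) (F : I -> RG) g :
    galg_mul g (\sum_(i <- r) F i) = \sum_(i <- r) galg_mul g (F i).
  exact: (big_morph (galg_mul g) (fun _ _ => galg_mulDr _ _ _) (galg_mulr0 _)).
rewrite galg_mulEl (galg_mulEl g1 g2) suml; apply/eq_bigr=> k1 _.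
rewrite (galg_mulEl g2) sumr (galg_mulEr _ g2) suml; apply/eq_bigr=> k2 _.
rewrite (galg_mulEr _ g3) sumr [RHS]galg_mulEr; apply/eq_bigr=> k3 _.
by rewrite !galg_mulUU mulrA mulgA.
Qed.

Fact galg_mul1 : left_id galg_one galg_mul.
Proof.
move=> g; rewrite galg_mulEr [RHS]monalgE.
by apply/eq_bigr=> k _; rewrite galg_mulUU mul1r mul1g.
Qed.

Fact galg_mulr1 : right_id galg_one galg_mul.
Proof.
move=> g; rewrite galg_mulEl [RHS]monalgE.
by apply/eq_bigr=> k _; rewrite galg_mulUU mulr1 mulg1.
Qed.

Fact galg_one_neq0 : galg_one != 0.
Proof.
by apply/eqP => /malgP/(_ 1%g)/eqP; rewrite mcoeffUU mcoeff0 oner_eq0.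
Qed.

HB.instance Definition _ := GRing.Zmodule_isNzRing.Build RG
  galg_mulA galg_mul1 galg_mulr1 galg_mulDl galg_mulDr galg_one_neq0.

Fact galg_scaleAl c g1 g2 : c *: (g1 * g2 : RG) = c *: g1 * g2.
Proof.
have leZ : (msupp (c *: g1 : {malg R[G]}) `<=` msupp g1)%fset by apply: msuppZ_le.
rewrite [RHS](galg_mulw leZ (fsubset_refl _)) [g1 * g2]/(galg_mul _ _) /galg_mul.
rewrite scaler_sumr; apply/eq_bigr=> k1 _.
rewrite scaler_sumr; apply/eq_bigr=> k2 _.
apply/malgP=> k; rewrite mcoeffZ !mcoeffU mulrnAr mulrA.
by rewrite -(mcoeffZ c (g1 : {malg R[G]})).
Qed.

HB.instance Definition _ := GRing.Lmodule_isLalgebra.Build R RG galg_scaleAl.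

End GroupAlgebra.

(* A left module over the converse ring R^c is a right module over R; see     *)
(* rscaleA.                                                                   *)
Notation rmodType R := (lmodType (GRing.converse R)).

Definition rscale (R : nzRingType) (M : rmodType R) (x : M) (a : R) : M :=
  (a : R^c) *: x.

Lemma rscaleA (R : nzRingType) (M : rmodType R) (x : M) (a b : R) :
  rscale (rscale x a) b = rscale x (a * b).
Proof. exact: scalerA. Qed.

(* GRing.submod_closed concerns boolean predicates only; submodules are taken *)
(* here to be arbitrary subsets.                                              *)
Definition is_rsubmodule (R : nzRingType) (M : rmodType R) (N : M -> Prop) :=
  [/\ N 0, forall x y, N x -> N y -> N (x + y)
    & forall x a, N x -> N (rscale x a)].

Definition simple_rmod (R : nzRingType) (M : rmodType R) : Prop :=
  (exists x : M, x <> 0) /\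
  forall N : M -> Prop, is_rsubmodule N ->
    (forall x, N x -> x = 0) \/ (forall x, N x).

Definition rmod_iso (R : nzRingType) (M N : rmodType R) : Prop :=
  exists f : {linear M -> N}, bijective f.

(* Main.v *)
(* Let c : int -> K be injective with nonzero values, and let V have basis    *)
(* (e_k), k in int. One generator of F_2 acts by e_k |-> c k e_k, the other   *)
(* by e_k |-> e_(k+1). The eigenvalues c k being distinct, a nonzero          *)
(* submodule contains some e_k (take an element of minimal support), hence    *)
(* all of them, so V is simple. The set of values of c is the set of          *)
(* eigenvalues of the first generator, so it is an isomorphism invariant; an  *)
(* infinite K has continuum many such sets.                                   *)
Require Import Defs.
From mathcomp Require Import all_boot all_algebra.
From HB Require Import structures.
From mathcomp Require Import finmap monalg zify.
From Stdlib Require Import Classical FunctionalExtensionality.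

Set Implicit Arguments.
Unset Strict Implicit.
Unset Printing Implicit Defensive.

Import GRing.Theory.

Local Open Scope ring_scope.

(** An injective family [c] of nonzero scalars indexed by the integers gives a module on which one
    generator is diagonal with distinct eigenvalues and the other is the shift. Simplicity:
    subtracting eigenvalues isolates a basis vector inside any nonzero submodule ([diag_invariant]),
    and the shift carries it to the whole basis. Non-isomorphism: an isomorphism preserves the
    eigenvalues of the diagonal generator ([weight_mod_iso]), and a bit sequence [s] can be read off
    from the eigenvalues that encode it ([branch_index_sub]). *)

Record right_rep (K : fieldType) (G : groupType) (V : lmodType K) := RightRep {
  rep :> G -> V -> V;
  rep_linear : forall g, linear (rep g);
  rep1 : forall x, rep 1%g x = x;
  repM : forall g h x, rep (g * h)%g x = rep h (rep g x)
}.

(** * From group representations to right modules over the group algebra *)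

Section RepModule.
Variables (K : fieldType) (G : groupType) (V : lmodType K).
Variable r : right_rep G V.

HB.instance Definition _ g := GRing.isLinear.Build K V V _ (r g) (rep_linear r g).

(* The representation is a phantom argument: it selects the module structure. *)
Definition rep_mod of right_rep G V : Type := V.

HB.instance Definition _ := GRing.Zmodule.copy (rep_mod r) V.

Definition rep_scale (g : {malg K[G]}) (x : V) : V :=
  \sum_(k <- msupp g) g@_k *: r k x.

Lemma rep_scalew (d : {fset G}) (g : {malg K[G]}) x :
  (msupp g `<=` d)%fset -> rep_scale g x = \sum_(k <- d) g@_k *: r k x.
Proof.
move=> le; rewrite /rep_scale (big_fset_incl _ le) // => k _ /mcoeff_outdom ->.
by rewrite scale0r.
Qed.

Lemma rep_scaleU c k x : rep_scale << c *g k >> x = c *: r k x.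
Proof. by rewrite (rep_scalew _ msuppU_le) big_seq_fset1 mcoeffUU. Qed.

Lemma rep_scaleDl x : {morph rep_scale^~ x : g h / g + h}.
Proof.
move=> g h; rewrite (rep_scalew _ (msuppD_le g h)).
rewrite (rep_scalew _ (fsubsetUl (msupp g) (msupp h))).
rewrite (rep_scalew _ (fsubsetUr (msupp g) (msupp h))) -big_split /=.
by apply/eq_bigr=> k _; rewrite mcoeffD scalerDl.
Qed.

Lemma rep_scale0 x : rep_scale 0 x = 0.
Proof. by rewrite /rep_scale msupp0 big_seq_fset0. Qed.

Lemma rep_scaleDr g : {morph rep_scale g : x y / x + y}.
Proof.
move=> x y; rewrite -big_split /=; apply/eq_bigr=> k _.
by rewrite linearD scalerDr.
Qed.

Lemma rep_scaleA (g h : group_algebra K G) x :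
  rep_scale h (rep_scale g x) = rep_scale (g * h) x.
Proof.
have suml I (s : seq I) (F : I -> {malg K[G]}) :
    rep_scale (\sum_(i <- s) F i) x = \sum_(i <- s) rep_scale (F i) x.
  exact: (big_morph (rep_scale^~ x) (rep_scaleDl x) (rep_scale0 x)).
rewrite [g * h]/(galg_mul _ _) /galg_mul suml.
under [RHS]eq_bigr do rewrite suml.
rewrite exchange_big /= {1}/rep_scale; apply/eq_bigr=> l _.
rewrite /rep_scale linear_sum scaler_sumr; apply/eq_bigr=> k _.
by rewrite -/(rep_scale _ _) rep_scaleU repM linearZ /= scalerA mulrC.
Qed.

Local Notation KG := (group_algebra K G).

(** The product of [g] and [h] in the converse ring is [h * g], hence the swapped arguments of
    [rep_scaleA]. *)
HB.instance Definition _ := GRing.Zmodule_isLmodule.Build KG^c (rep_mod r)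
  (fun g h x => rep_scaleA h g x)
  (fun x => etrans (rep_scaleU 1 1%g x) (etrans (scale1r _) (rep1 r x)))
  rep_scaleDr (fun x g h => rep_scaleDl x g h).

Lemma rscale_rep (x : rep_mod r) (c : K) (g : G) :
  rscale x (<< c *g g >> : KG) = c *: r g x :> V.
Proof. exact: rep_scaleU. Qed.

End RepModule.

(** * Actions of reduced words *)

Section WordAction.
Variables (X : choiceType) (T : Type) (act : X * bool -> T -> T).
Hypothesis actK : forall a, cancel (act a) (act (letter_inv a)).

Definition word_act (w : seq (X * bool)) (x : T) : T :=
  foldl (fun y a => act a y) x w.

(** Free reduction only deletes a letter next to its inverse, and by [actK] such a pair acts
    trivially. *)
Lemma word_act_cons a w x : word_act (word_cons a w) x = word_act w (act a x).
Proof. by case: w => [|b w] //=; case: eqP => //= ->; rewrite actK. Qed.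

Lemma word_act_mul u v x :
  word_act (word_mul u v) x = word_act v (word_act u x).
Proof. by elim: u x => //= a u IH x; rewrite word_act_cons IH. Qed.

End WordAction.

(** * Monomial and diagonal operators *)

Section MonomialMap.
Variables (K : fieldType) (I : choiceType).
Implicit Types (c : I -> K) (p : I -> I) (x : {malg K[I]}).

Definition monomial_map c p x : {malg K[I]} :=
  \sum_(k <- msupp x) << c k * x@_k *g p k >>.

Lemma monomial_mapw c p (d : {fset I}) x : (msupp x `<=` d)%fset ->
  monomial_map c p x = \sum_(k <- d) << c k * x@_k *g p k >>.
Proof.
move=> le; rewrite /monomial_map (big_fset_incl _ le) // => k _ /mcoeff_outdom ->.
by rewrite mulr0 monalgU0.
Qed.

Lemma monomial_map_linear c p : linear (monomial_map c p).
Proof.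
move=> a x y; pose d := (msupp x `|` msupp y)%fset.
have lexy : (msupp (a *: x + y) `<=` d)%fset.
  by apply: fsubset_trans (msuppD_le _ _) (fsetSU _ (msuppZ_le _ _)).
rewrite (monomial_mapw _ _ lexy) (monomial_mapw _ _ (fsubsetUl _ (msupp y))).
rewrite (monomial_mapw _ _ (fsubsetUr (msupp x) _)) scaler_sumr -big_split /=.
apply/eq_bigr=> k _; apply/malgP=> l.
by rewrite !(mcoeffD, mcoeffZ, mcoeffU) mulrDr mulrnDl mulrnAr mulrCA.
Qed.

HB.instance Definition _ c p := GRing.isLinear.Build K {malg K[I]} {malg K[I]} _
  (monomial_map c p) (monomial_map_linear c p).

Lemma monomial_mapU c p a k :
  monomial_map c p << a *g k >> = << c k * a *g p k >>.
Proof. by rewrite (monomial_mapw _ _ msuppU_le) big_seq_fset1 mcoeffUU. Qed.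

Lemma monomial_mapK c p c' p' :
    (forall k, c' (p k) * c k = 1) -> cancel p p' ->
  cancel (monomial_map c p) (monomial_map c' p').
Proof.
move=> cK pK x; rewrite [RHS]monalgE linear_sum /=; apply/eq_bigr=> k _.
by rewrite monomial_mapU pK mulrA cK mul1r.
Qed.

Lemma msupp_neq0 x : x <> 0 -> exists k, k \in msupp x.
Proof.
case: (fset_0Vmem (msupp x)) => [x0|[k kx] _]; last by exists k.
by case; rewrite [x]monalgE x0 big_seq_fset0.
Qed.

Lemma mcoeff_diag c x k : (monomial_map c id x)@_k = c k * x@_k.
Proof.
rewrite {1}/monomial_map raddf_sum /=; have [kx|kx] := boolP (k \in msupp x).
  rewrite (big_fsetD1 k) //= mcoeffUU big_seq big1 ?addr0 // => l.
  by rewrite !inE mcoeffU => /andP[/negPf-> _].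
rewrite (mcoeff_outdom kx) mulr0 big_seq big1 // => l lx.
by rewrite mcoeffU; case: eqP lx kx => // -> ->.
Qed.

Lemma diag_eigenvalue c x a :
  x <> 0 -> monomial_map c id x = a *: x -> exists k, c k = a.
Proof.
move=> x0 /malgP e; have [k kx] := msupp_neq0 x0.
exists k; have/mulIf: x@_k != 0 by rewrite mcoeff_neq0.
by apply; rewrite -mcoeff_diag e mcoeffZ.
Qed.

(** Induction on the size of the support. For [k] in the support of [x], applying the diagonal
    operator minus [c k] kills the coordinate [k] and rescales the others. The result is a nonzero
    vector of smaller support, or it is zero and then, [c] being injective, [x] is a multiple of the
    basis vector at [k]. *)
Lemma diag_invariant c (N : {malg K[I]} -> Prop) : injective c ->
    (forall x y, N x -> N y -> N (x + y)) -> (forall a x, N x -> N (a *: x)) ->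
    (forall x, N x -> N (monomial_map c id x)) ->
  forall x, N x -> x <> 0 -> exists k, N << k >>.
Proof.
move=> cI ND NZ Nc x; have [n] := ubnP #|` msupp x|.
elim: n x => // n IH x le_n Nx x0.
have [k kx] := msupp_neq0 x0.
pose y := monomial_map c id x + (- c k) *: x.
have yE l : y@_l = (c l - c k) * x@_l.
  by rewrite mcoeffD mcoeffZ mcoeff_diag mulrBl mulNr.
have [y0|y0] := eqVneq y 0.
  exists k; have -> : << k >> = (x@_k)^-1 *: x.
    apply/malgP=> l; rewrite mcoeffZ mcoeffU; case: eqVneq => [<-|kl].
      by rewrite mulVf ?mcoeff_neq0.
    have /eqP := yE l; rewrite y0 mcoeff0 eq_sym mulf_eq0 subr_eq0.
    by rewrite (inj_eq cI) eq_sym (negPf kl) => /eqP->; rewrite mulr0.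
  exact: NZ.
apply: (IH y); [|by apply: ND; [apply: Nc | apply: NZ]|exact/eqP].
rewrite ltnS in le_n; apply: leq_trans le_n; apply: fproper_ltn_card.
apply: fsub_proper_trans (fproperD1 kx); apply/fsubsetP=> l.
rewrite !inE -!mcoeff_neq0 yE mulf_eq0 negb_or subr_eq0 => /andP[+ ->].
by rewrite andbT; apply: contraNneq => ->.
Qed.

End MonomialMap.

(** * The weight modules and their simplicity *)

Section WeightModule.
Variables (K : fieldType) (c : int -> K).
Hypotheses (c0 : forall k, c k != 0) (c_inj : injective c).

Local Notation V := {malg K[int]}.
Local Notation F2 := (free_group 'I_2).
Local Notation KF2 := (group_algebra K F2).

Definition letter_weight (a : 'I_2 * bool) (k : int) : K :=
  if a.1 == ord0 then if a.2 then c k else (c k)^-1 else 1.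

Definition letter_shift (a : 'I_2 * bool) (k : int) : int :=
  if a.1 == ord0 then k else if a.2 then k + 1 else k - 1.

Definition letter_map a : V -> V :=
  monomial_map (letter_weight a) (letter_shift a).

HB.instance Definition _ a := GRing.Linear.on (letter_map a).

Lemma letter_mapK a : cancel (letter_map a) (letter_map (letter_inv a)).
Proof.
apply: monomial_mapK => k; case: a => i b;
  rewrite /letter_weight /letter_shift /letter_inv /=; case: eqP => // _.
- by case: b; rewrite /= ?mulVf ?mulfV.
- by rewrite mulr1.
- by case: b; rewrite /= ?addrK ?subrK.
Qed.

Fact weight_rep_linear (g : F2) : linear (word_act letter_map (word g)).
Proof.
elim: (word g) => // a w IH k x y.
rewrite -[LHS]/(word_act letter_map w (letter_map a _)) linearP.
exact: IH.
Qed.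

Definition weight_rep : right_rep F2 V :=
  RightRep weight_rep_linear (fun x => erefl)
    (fun g h => word_act_mul letter_mapK (word g) (word h)).

Definition weight_mod : rmodType KF2 := rep_mod weight_rep.

Definition diag_elt : KF2 := << fgroup_gen ord0 >>.

Lemma rscale_diag (x : weight_mod) :
  rscale x diag_elt = monomial_map c id (x : V).
Proof. by rewrite rscale_rep scale1r. Qed.

Lemma rscale_const (x : weight_mod) (a : K) :
  rscale x (<< a *g 1%g >> : KF2) = a *: (x : V).
Proof. exact: rscale_rep. Qed.

Lemma weight_mod_simple : simple_rmod weight_mod.
Proof.
split.
  exists (<< 0 >> : V) => /malgP/(_ 0)/eqP.
  by rewrite mcoeffUU mcoeff0 oner_eq0.
move=> N [N0 ND NA].
case: (classic (exists2 x, N x & x <> 0)) => [[x Nx x0]|noN]; last first.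
  by left=> x Nx; apply: NNPP => x0; apply: noN; exists x.
(* Scalars act through multiples of the group identity, so a submodule is also a [K]-subspace, as
   [diag_invariant] requires. *)
right; have NZ a y : N y -> N (a *: (y : V)).
  by rewrite -rscale_const; apply: NA.
have [||k Nk] := @diag_invariant _ _ c N c_inj ND _ _ x Nx x0.
- by move=> a y; apply: NZ.
- by move=> y; rewrite -rscale_diag; apply: NA.
have Nshift b l : N (<< l >> : V) ->
    N (<< if b then l + 1 else l - 1 >> : V).
  move=> /NA; set i : 'I_2 := lift ord0 ord0.
  move/(_ (<< FreeGroup (isT : reduced [:: (i, b)]) >> : KF2)).
  by rewrite rscale_rep scale1r /= /letter_map monomial_mapU mulr1.
(* Unit shifts in both directions reach every [l] from [k], by induction on [l - k]. *)
have Nall l : N (<< l >> : V).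
  rewrite -[l](subrK k); elim/int_ind: (l - k) => [|n IH|n IH]; first by rewrite add0r.
    by rewrite intS -addrA addrC; apply: (Nshift true).
  by rewrite intS opprD -addrA addrC; apply: (Nshift false).
move=> y; rewrite (monalgE (y : V)); elim/big_ind: _ => // l _.
have -> : << (y : V)@_l *g l >> = (y : V)@_l *: (<< l >> : V).
  by apply/malgP=> m; rewrite mcoeffZ !mcoeffU mulrnAr mulr1.
exact: NZ.
Qed.

End WeightModule.

(** * Eigenvalues as an isomorphism invariant, and a continuum of eigenvalue sets *)

Lemma weight_mod_iso (K : fieldType) (c d : int -> K)
    (c0 : forall k, c k != 0) (d0 : forall k, d k != 0) :
  rmod_iso (weight_mod c0) (weight_mod d0) -> forall k, exists l, d l = c k.
Proof.
case=> f f_bij k; pose e : weight_mod c0 := (<< k >> : {malg K[int]}).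
have e_eigen : monomial_map c id << k >> = c k *: << k >> :> {malg K[int]}.
  by rewrite monomial_mapU; apply/malgP=> m; rewrite mcoeffZ !mcoeffU mulrnAr.
(* The eigenvector equation becomes an equality between the actions of two elements of the group
   algebra, which any module morphism transports. *)
have ev : rscale e (diag_elt K) = rscale e << c k *g 1%g >>.
  exact: etrans (rscale_diag e) (etrans e_eigen (esym (rscale_const e _))).
have fA g : f (rscale e g) = rscale (f e) g by exact: linearZ.
have fev := etrans (esym (fA _)) (etrans (congr1 f ev) (fA _)).
apply: (@diag_eigenvalue _ _ d (f e) (c k)).
  move=> fe0; have /malgP/(_ k)/eqP : e = 0 :> weight_mod c0.
    by apply: (bij_inj f_bij); rewrite fe0 linear0.
  by rewrite mcoeffUU mcoeff0 oner_eq0.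
exact: etrans (esym (rscale_diag (f e))) (etrans fev (rscale_const (f e) _)).
Qed.

(* No 3 * n + 2 is of the form 3 * m + t m, so the set of values determines s. *)
Definition branch_index (s : nat -> bool) (k : int) : nat :=
  match k with Posz n => 3 * n + s n | Negz n => 3 * n + 2 end.

Lemma branch_index_inj s : injective (branch_index s).
Proof.
move=> [] m [] n /=; move: (s m) (s n) => [] [] /= e; lia.
Qed.

(** One inclusion of value sets suffices: dividing by 3 forces [m = n], and the remainder is the
    bit. *)
Lemma branch_index_sub s t :
    (forall k, exists l, branch_index t l = branch_index s k) -> s =1 t.
Proof.
move=> sub n; have [[] m /= e] := sub n; last by move: e; case: (s n) => /=; lia.
have mn : m = n by move: e; case: (s n); case: (t m) => /=; lia.
by move: e; rewrite mn => /addnI; case: (s n); case: (t n).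
Qed.

Theorem theorem8p1 (K : fieldType) (cardK : exists e : nat -> K, bijective e)
    (charK : 2%N \notin [pchar K]) :
  exists M : (nat -> bool) -> rmodType (group_algebra K (free_group 'I_2)),
    (forall s : nat -> bool, simple_rmod (M s)) /\
    (forall s t : nat -> bool, s <> t -> ~ rmod_iso (M s) (M t)).
Proof.
case: cardK => e [g eK gK].
(* Starting the enumeration after [g 0], the index of zero, keeps all values nonzero. *)
pose c n := e (g 0%R + n.+1)%N.
have cI : injective c by move=> m n /(can_inj eK); lia.
have c0 n : c n != 0 by apply/eqP => /(congr1 g); rewrite eK; lia.
exists (fun s => weight_mod (fun k => c0 (branch_index s k))); split=> [s|s t].
  by apply: weight_mod_simple => k l /cI /branch_index_inj.
move=> st /weight_mod_iso iso; apply: st; apply: functional_extensionality.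
apply: branch_index_sub => k; by have [l /cI <-] := iso k; exists l.
Qed.
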